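(* Assume that any continuous image of a Hausdorff topological space $X$ is a LOTS. Then $X$ is homeomorphic to a countable successor ordinal (endowed with its order topology).
   Context: All topological spaces are assumed to be Hausdorff (so a ''continuous image of $X$'' means a Hausdorff space $Y$ for which there is a continuous surjection $X\to Y$; in particular $X$ is a continuous image of itself). A linearly ordered topological space (LOTS) is a topological space $L$ for which there is a linear order $\le^L$ on $L$ whose order topology (the topology generated by the open intervals and open rays of $\le^L$, for which the open convex sets form a base) is the topology of $L$. A countable successor ordinal is an ordinal of the form $\alpha+1$ with $\alpha$ a countable (possibly finite) ordinal.
   Formalization: The space X is assumed nonempty: the empty space is its own only continuous image and is trivially a LOTS, but it is not homeomorphic to any successor ordinal, since those are nonempty. *)

(* Defs.v *)
From HB Require Import structures.
From mathcomp Require Import all_boot all_order all_algebra.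
From mathcomp Require Import all_classical wochoice topology.

Set Implicit Arguments.
Unset Strict Implicit.
Unset Printing Implicit Defensive.

Local Open Scope classical_set_scope.

Definition homeomorphic (X Y : topologicalType) : Prop :=
  exists (f : X -> Y) (g : Y -> X),
    [/\ cancel f g, cancel g f, continuous f & continuous g].

Definition continuous_image (X Y : topologicalType) : Prop :=
  hausdorff_space Y /\ exists2 f : X -> Y, continuous f & range f = [set: Y].

(* [le] ranges over all total orders on the carrier of [L]: a term of type
   [Order.Total.axioms_ d L] packs such an order with its derived operations,
   and [order_topology] ignores the topology of [L].  The display [d] carries
   no mathematical content. *)
Definition LOTS (L : topologicalType) : Prop :=
  exists (d : Order.disp_t) (le : Order.Total.axioms_ d L),
    @open L = @open (order_topology (Order.Total.Pack le)).

(* An ordinal is represented by a well-ordered type [A]; its successor is then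
   represented by [A] with a new greatest element [None] added. *)
Definition osucc (A : Type) : Type := option A.

HB.instance Definition _ (A : choiceType) := Choice.on (osucc A).

Section SuccessorOrder.
Context (d : Order.disp_t) (A : orderType d).

Definition osucc_le (x y : osucc A) : bool :=
  match x, y with
  | _, None => true
  | None, Some _ => false
  | Some a, Some b => (a <= b)%O
  end.

Lemma osucc_le_refl : reflexive osucc_le.
Proof. by case=> [a|] //=; exact: Order.POrderTheory.lexx. Qed.

Lemma osucc_le_anti : antisymmetric osucc_le.
Proof. by case=> [a|] [b|] //= /Order.POrderTheory.le_anti ->. Qed.

Lemma osucc_le_trans : transitive osucc_le.
Proof. by case=> [b|] [a|] [c|] //=; exact: Order.POrderTheory.le_trans. Qed.

Lemma osucc_le_total : total osucc_le.
Proof. by case=> [a|] [b|] //=; exact: Order.TotalTheory.le_total. Qed.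

HB.instance Definition _ := Order.Le_isPOrder.Build d (osucc A)
  osucc_le_refl osucc_le_anti osucc_le_trans.

HB.instance Definition _ := Order.POrder_isTotal.Build d (osucc A)
  osucc_le_total.

End SuccessorOrder.

Definition homeomorphic_to_countable_successor_ordinal (X : topologicalType) : Prop :=
  exists (d : Order.disp_t) (A : orderType d),
    [/\ wochoice.well_order (@Order.le d A), countable [set: A]
      & homeomorphic X (order_topology (osucc A))].

(* Main.v *)
(* Two kinds of continuous images drive the argument.  First, spaces [option T]
   whose only possibly non-isolated point [None] has a prescribed neighbourhood filter:
   with the cofinite filter they show that [X] has countably many isolated
   points, and with the fan filter on [nat * nat] (which has uncountable character)
   that [X] does not map onto an infinite discrete space, so that a sequence of
   clopen sets with clopen union has a finite subfamily with the same union.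
   Second, a closed curve in the plane, which is not a LOTS since removing a point
   does not disconnect it: if some nonempty [P] in [X] had no isolated point, the
   relation "[P] meets the open interval (a, b)" would be dense and yield a
   continuous monotone [f : X -> [0, 1]] with dense range, whence either
   a surjection of [X] onto a segment, hence onto the curve, or a sequence of clopen
   sets [f < s n] contradicting the previous point.
   So [X] is scattered with countably many, densely placed, isolated points;
   this rules out gaps, whence [X] is compact, and makes the complement of each point
   a countable union of clopen sets.  Finally, call a set ordinal-like when it
   is countable and has a well-order with clopen initial segments; peeling off clopen
   shells shows that the set of points without an ordinal-like clopen neighbourhood
   has no isolated point, so it is empty, and compactness makes [X] ordinal-like. *)
From HB Require Import structures.
Require Import Defs.
From mathcomp Require Import finmap all_boot all_order all_algebra ring lra.
From mathcomp Require Import all_classical reals topology normedtype Rstruct.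

Set Implicit Arguments.
Unset Strict Implicit.
Unset Printing Implicit Defensive.

Local Open Scope classical_set_scope.

(** * LOTS by order boxes *)

Definition image_LOTS (X : topologicalType) : Prop :=
  forall Y : topologicalType, continuous_image X Y -> LOTS Y.

(* The open interval from [a] to [b] around [x], where an endpoint on the wrong side of
   [x] (for instance [x] itself) imposes no condition: rays need no separate case. *)
Definition order_box (T : Type) (lt : T -> T -> Prop) (x a b : T) : set T :=
  [set y | (lt a x -> lt a y) /\ (lt x b -> lt y b)].

(** A bare strict relation rather than an [orderType]: reversing it gives a second instance over the
    same space, so one-sided arguments are made only once. *)
Record order_generated (T : topologicalType) (lt : T -> T -> Prop) : Prop :=
  OrderGenerated {
    og_irr : forall x, ~ lt x x;
    og_trans : forall x y z, lt x y -> lt y z -> lt x z;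
    og_total : forall x y, [\/ lt x y, x = y | lt y x];
    og_nbhs : forall (x : T) (U : set T),
      nbhs x U <-> exists a b, order_box lt x a b `<=` U }.

Lemma order_generated_flip (T : topologicalType) (lt : T -> T -> Prop) :
  order_generated lt -> order_generated (fun x y => lt y x).
Proof.
move=> [irr tr tot nb]; split=> // [x y z xy yz|x y|x U].
- exact: tr yz xy.
- by case: (tot x y) => ?; [constructor 3|constructor 2|constructor 1].
- by rewrite nb; split=> -[a [b sU]]; exists b, a => y [? ?]; apply: sU.
Qed.

Lemma order_topology_generated d (T : orderType d) :
  @order_generated (order_topology T) (fun x y : T => (x < y)%O).
Proof.
split.
- by move=> x; rewrite Order.POrderTheory.ltxx.
- by move=> x y z; apply: Order.POrderTheory.lt_trans.
- move=> x y; case: (Order.TotalTheory.ltgtP x y) => ?;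
    by [constructor 1|constructor 3|constructor 2].
- move=> x U; rewrite order_nbhs_itv; split; last first.
    move=> [a [b sU]].
    pose l := if (a < x)%O then BRight a else -oo%O.
    pose r := if (x < b)%O then BLeft b else +oo%O.
    exists (Interval l r).
      rewrite /l /r itv_boundlr /itv_open_ends /itv_is_open_unbounded.
      by case: ifP => ?; case: ifP => ? //=; split => //; rewrite ?orbT //;
        apply/andP; split.
    move=> y /=; rewrite /l /r itv_boundlr => /andP[ly yr]; apply: sU; split.
      by move=> ax; rewrite ax in ly.
    by move=> xb; rewrite xb in yr.
  case=> -[l r] [/= oi xi sU].
  exists (match l with BSide _ a => a | BInfty _ => x end).
  exists (match r with BSide _ a => a | BInfty _ => x end).
  move=> y [ly yr]; apply: sU; move: oi xi => /=.
  rewrite /= !itv_boundlr /itv_open_ends /itv_is_open_unbounded.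
  case: l ly => [[] a|[]]; case: r yr => [[] b|[]] //= yr ly _;
    rewrite ?bnd_simp /<=%O /=; case/andP => ? ?; apply/andP; split => //=;
    by [apply: ly|apply: yr].
Qed.

Lemma LOTS_order (L : topologicalType) :
  LOTS L -> exists lt, @order_generated L lt.
Proof.
move=> [d [le ole]]; have [irr tr tot nb] := order_topology_generated (Order.Total.Pack le).
exists (fun x y => @Order.lt d (Order.Total.Pack le) x y); split=> //.
move=> x U; rewrite -nb !nbhsE.
by split=> -[V [oV Vx] sV]; exists V => //; split=> //; move: oV; rewrite ole.
Qed.

(** * Spaces with one non-isolated point *)

(** The alias records [F], so that the topology declared below can depend on it. *)
Definition filter_space (T : choiceType) (F : filter_on T) : Type := option T.

Section FilterSpace.
Context (T : choiceType) (F : filter_on T).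

HB.instance Definition _ := Choice.on (filter_space F).

Definition filter_space_open : set_system (filter_space F) :=
  [set U | U None -> (F : set_system T) (Some @^-1` U)].

Lemma filter_space_openT : filter_space_open [set: filter_space F].
Proof. by move=> _; exact: filterT. Qed.

Lemma filter_space_openI : setI_closed filter_space_open.
Proof. by move=> U V oU oV [/oU FU /oV FV]; exact: filterI. Qed.

Lemma filter_space_open_bigU (I : Type) (U : I -> set (filter_space F)) :
  (forall i, filter_space_open (U i)) -> filter_space_open (\bigcup_i U i).
Proof.
by move=> oU [i _ /oU]; apply: filterS => t Ut; exists i.
Qed.

HB.instance Definition _ := isOpenTopological.Build (filter_space F)
  filter_space_openT filter_space_openI filter_space_open_bigU.

Lemma filter_space_openE (U : set (filter_space F)) :
  open U = (U None -> (F : set_system T) (Some @^-1` U)).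
Proof. by []. Qed.

Lemma filter_space_nbhs_None (U : set (filter_space F)) :
  U None -> nbhs (None : filter_space F) U = (F : set_system T) (Some @^-1` U).
Proof.
move=> UN; rewrite nbhsE; apply/propext; split.
  by move=> [V [oV VN] VU]; apply: filterS (oV VN) => t; apply: VU.
by move=> FU; exists U => //; split=> //; rewrite filter_space_openE.
Qed.

Lemma filter_space_hausdorff :
  (forall t : T, (F : set_system T) (~` [set t])) -> hausdorff_space (filter_space F).
Proof.
move=> Ffree; rewrite open_hausdorff.
have oS t : open ([set Some t] : set (filter_space F)) by [].
have oC t : open (~` [set Some t] : set (filter_space F)).
  by move=> _; apply: filterS (Ffree t) => s /= st [].
move=> [s|] [t|] // xy; last 2 first.
- exists ([set Some s], ~` [set Some s]); first by rewrite !inE.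
  by split; rewrite ?setICr //=; apply: oC.
- exists (~` [set Some t], [set Some t]); first by rewrite !inE.
  by split; rewrite ?setICl //=; apply: oC.
exists ([set Some s], ~` [set Some s]); last by split; rewrite ?setICr //=; apply: oC.
by rewrite !inE; split=> // ts; move: xy; rewrite ts eqxx.
Qed.

End FilterSpace.

Lemma infinite_set_seq (T : Type) (A : set T) :
  infinite_set A -> exists2 e : nat -> T, injective e & forall n, A (e n).
Proof.
move=> /infiniteP/card_leP[f].
exists (fun n => set_val (f (SigSub (mem_set (I : [set: nat] n))))) => [m n emn|n].
  have /(congr1 val) := inj (mem_set I) (mem_set I) (val_inj emn).
  by [].
by have := set_valP (f (SigSub (mem_set (I : [set: nat] n)))).
Qed.

(** If [L] is infinite, pick distinct points [e n] in it. A point [t] with [R (e n) t] for all [n]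
    would have, by asymmetry, infinitely many [s] with [~ R t s]; hence the finite sets attached to
    the [e n] cover [L]. *)
Lemma countable_of_finite_segments (T : Type) (L : set T) (R : T -> T -> Prop) :
    (forall s t, R s t -> ~ R t s) ->
    (forall t, L t -> finite_set [set s | L s /\ ~ R t s]) ->
  countable L.
Proof.
move=> Rasym Lfin; have [/finite_set_countable//|/infinite_set_seq[e e_inj eL]] :=
  pselect (finite_set L).
apply: (@sub_countable _ _ _ (\bigcup_n [set s | L s /\ ~ R (e n) s])).
  apply: subset_card_le => t Lt; apply: contrapT => nt.
  have et n : R (e n) t by apply: contrapT => ?; apply: nt; exists n.
  apply: infinite_nat; apply: (@sub_finite_set _ _ (e @^-1` [set s | L s /\ ~ R t s])).
    by move=> n _; split; [exact: eL|exact: Rasym].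
  by apply: finite_preimage (Lfin _ Lt) => m n _ _; apply: e_inj.
apply: bigcup_countable => // n _; apply/finite_set_countable/Lfin/eL.
Qed.

Lemma cofinite_filter (T : Type) : Filter [set A : set T | finite_set (~` A)].
Proof.
split=> [|A B fA fB|A B AB /= fA] /=.
- by rewrite setCT.
- by rewrite setCI finite_setU.
- by apply: sub_finite_set fA; exact: subsetC.
Qed.

Definition cofinite_filter_on (T : Type) : filter_on T :=
  FilterType _ (@cofinite_filter T).

Lemma cofinite_space_LOTS_countable (T : choiceType) :
  LOTS (filter_space (cofinite_filter_on T)) -> countable [set: T].
Proof.
move=> /LOTS_order[lt0 og0].
suff below lt : @order_generated (filter_space (cofinite_filter_on T)) lt ->
    countable [set t | lt (Some t) None].
  have -> : [set: T] = [set t | lt0 (Some t) None] `|` [set t | lt0 None (Some t)].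
    apply/seteqP; split=> // t _; case: (og_total og0 (Some t) None) => //; by [left|right].
  rewrite -bigcup2E; apply: bigcup_countable => // -[|[|n]] _ /=.
  - exact: below og0.
  - exact: below (order_generated_flip og0).
  - exact: countable0.
move=> og; pose R (s t : T) := lt (Some s) (Some t).
(* The ray from [Some t] towards [None] is a neighbourhood of [None], hence omits only finitely many
   points: this is the finiteness required of [R]. *)
apply: (@countable_of_finite_segments _ _ R) => [s t st ts|t /= tN].
  by apply: (og_irr og); apply: (og_trans og) st ts.
have : nbhs (None : filter_space (cofinite_filter_on T)) (order_box lt None (Some t) None).
  by apply/(og_nbhs og); exists (Some t), None.
rewrite filter_space_nbhs_None; last by split.
apply: sub_finite_set => s [sN nts] [ts _]; exact/nts/ts.
Qed.

Definition fan : set_system (nat * nat) :=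
  [set A | forall n, exists M, forall m, M <= m -> A (n, m)].

Lemma fan_filter : Filter fan.
Proof.
split=> [n|A B FA FB n|A B AB FA n]; first by exists 0.
  have [M AM] := FA n; have [N BN] := FB n; exists (maxn M N) => m.
  by rewrite geq_max => /andP[/AM Am /BN Bm].
by have [M AM] := FA n; exists M => m /AM /AB.
Qed.

Definition fan_on : filter_on (nat * nat) := FilterType _ fan_filter.

(* Diagonalisation: the fan has uncountable character at its limit point, while
   the order boxes with endpoints in a countable set are countably many. *)
Lemma fan_space_not_LOTS : ~ LOTS (filter_space fan_on).
Proof.
move=> /LOTS_order[lt og].
pose box (p : option (nat * nat) * option (nat * nat)) := order_box lt None p.1 p.2.
have /choice[m boxm] : forall p, exists m, box p (Some (pickle p, m)).
  move=> p; have : nbhs (None : filter_space fan_on) (box p).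
    by apply/(og_nbhs og); exists p.1, p.2.
  rewrite filter_space_nbhs_None => [/(_ (pickle p))[M]|]; last by split.
  by move=> /(_ M (leqnn _)); exists M.
pose U : set (filter_space fan_on) := [set x | forall p, x <> Some (pickle p, m p)].
have : nbhs (None : filter_space fan_on) U.
  rewrite filter_space_nbhs_None // => n.
  have [[p pn]|np] := pselect (exists p : option (nat * nat) * option (nat * nat), pickle p = n).
    exists (m p).+1 => k mk q /= [nq kq]; move: mk.
    by rewrite kq (_ : p = q) ?ltnn//; apply: (pcan_inj pickleK); rewrite pn.
  by exists 0 => k _ q [nq _]; apply: np; exists q.
move=> /(og_nbhs og)[a [b abU]].
exact: (abU _ (boxm (a, b)) (a, b)).
Qed.

Lemma countable_isolated_points (X : topologicalType) :
  hausdorff_space X -> image_LOTS X -> countable [set x : X | open [set x]].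
Proof.
move=> hX imX; set D := [set x | _].
have [[d0 Dd0]|D0] := pselect (D !=set0); last first.
  by rewrite (_ : D = set0) ?countable0//; apply/seteqP; split=> // x Dx; case: D0; exists x.
(* The isolated point [d0] goes to [None] together with the non-isolated points, so that [None] is
   attained even if [X] is discrete. *)
pose T := set_type (D `\ d0).
suff cT : countable [set: T].
  have /card_eqPle[le1 _] : (D `\ d0 #= [set: T])%card by rewrite card_eq_sym card_setT.
  rewrite (_ : D = D `\ d0 `|` [set d0]); last first.
    apply/seteqP; split=> [x Dx|x [[]//|->//]].
    by have [->|/eqP xd0] := eqVneq x d0; [right|left].
  rewrite -bigcup2E; apply: bigcup_countable => // -[|[|n]] _ /=.
  - exact: sub_countable le1 cT.
  - exact: countable1.
  - exact: countable0.
apply: cofinite_space_LOTS_countable; apply: imX.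
split; first by apply: filter_space_hausdorff => t /=; rewrite setCK; exact: finite_set1.
pose h (x : X) : filter_space (cofinite_filter_on T) := insub x.
have hS (t : T) x : h x = Some t -> x = val t.
  by rewrite /h; case: insubP => // u _ <- [->].
exists h; last first.
  apply/seteqP; split=> // -[t|] _; last first.
    by exists d0 => //; rewrite /h insubF//; apply/negP => /set_mem[_]; apply.
  by exists (val t) => //; rewrite /h valK.
apply/continuousP => U oU.
have [UN|nUN] := pselect (U None).
  rewrite -[_ @^-1` _]setCK openC.
  apply: (@accessible_finite_set_closed X).1; first exact: hausdorff_accessible.
  apply: (@sub_finite_set _ _ (val @` (~` (Some @^-1` U)) : set X)).
    move=> x /= nUx; case hx: (h x) => [t|]; last by rewrite hx in nUx.
    by exists t; [move=> Ut; apply: nUx; rewrite hx|rewrite (hS _ _ hx)].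
  exact/finite_image/oU.
rewrite openE => x Ux; rewrite /interior nbhsE; exists [set x]; last by move=> _ ->.
split=> //; case hx: (h x) => [t|]; last by move: Ux; rewrite /= hx.
by rewrite (hS _ _ hx); have /set_mem[] := valP t.
Qed.

Lemma locally_constant_finite_range (X : topologicalType) (h : X -> nat) :
  image_LOTS X -> (forall n, open (h @^-1` [set n])) -> finite_set (range h).
Proof.
move=> imX oh; apply: contrapT => /infinite_set_seq[e e_inj erange].
have /choice[g gK] : forall k, exists n, forall m, e m = k -> m = n.
  move=> k; have [[n <-]|nk] := pselect (exists n, e n = k).
    by exists n => m /e_inj.
  by exists 0 => m mk; case: nk; exists m.
(* A map that factors through [h] is continuous into any topology, as the fibres of [h] are open.
   Decoding after [g] reaches all of the countable set [option (nat * nat)]; numbers that code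
   nothing go to [None]. *)
pose f x : filter_space fan_on := odflt None (unpickle (g (h x))).
apply: fan_space_not_LOTS; apply: imX; split.
  apply: filter_space_hausdorff => -[i j] n; exists j.+1 => m jm [_ mj].
  by rewrite mj ltnn in jm.
exists f.
  apply/continuousP => U _.
  rewrite (_ : f @^-1` U = 
      \bigcup_(n in [set n | U (odflt None (unpickle (g n)))]) h @^-1` [set n]).
    by apply: bigcup_open => n _; exact: oh.
  by apply/seteqP; split=> [x fx|x [n Un hx]]; [exists (h x)|rewrite /= /f hx].
apply/seteqP; split=> // y _; have [x _ hx] := erange (pickle y).
exists x; first exact: I.
have /esym gy := gK _ _ (esym hx).
by rewrite /f gy pickleK.
Qed.

(** Send a point to the least index [n] with [C n x], and to 0 off the union. This is locally
    constant on the union because the [C n] are clopen, and off it because the union is closed; the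
    finite range then bounds the indices. *)
Lemma clopen_bigcup_finite (X : topologicalType) (C : nat -> set X) :
    image_LOTS X -> (forall n, clopen (C n)) -> closed (\bigcup_n C n) ->
  exists N, \bigcup_n C n = \bigcup_(n < N) C n.
Proof.
move=> imX oC cU.
have /choice[h hP] : forall x, exists n, (C n x /\ forall m, m < n -> ~ C m x) \/
    ((forall m, ~ C m x) /\ n = 0).
  move=> x; have [[n Cn]|nC] := pselect (exists n, C n x); last first.
    by exists 0; right; split=> // m Cm; apply: nC; exists m.
  have ex : exists n, `[< C n x >] by exists n; apply/asboolP.
  exists (ex_minn ex); left; case: ex_minnP => m /asboolP Cm mmin; split=> // k km Ck.
  by have := mmin k (asboolT Ck); rewrite leqNgt km.
have oh n : open (h @^-1` [set n]).
  rewrite openE => x /= hx; rewrite /interior /=.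
  have [[Chx hmin]|[nC h0]] := hP x.
    have : nbhs x (C (h x) `&` ~` \bigcup_(m < h x) C m).
      apply: open_nbhs_nbhs; split.
        apply: openI; first by case: (oC (h x)).
        by apply: closed_openC; apply: closed_bigcup => // m _; case: (oC m).
      by split=> // -[m /= mh Cm]; exact: hmin mh Cm.
    apply: filterS => y [Cy nCy]; rewrite -hx; have [[Chy hminy]|[nC _]] := hP y; last first.
      by case: (nC (h x)).
    rewrite /=; case: (ltngtP (h y) (h x)) => // hxy; last by case: (hminy _ hxy Cy).
    by case: nCy; exists (h y).
  have : nbhs x (~` \bigcup_n C n).
    by apply: open_nbhs_nbhs; split; [exact: closed_openC|move=> [m _ /nC]].
  apply: filterS => y nCy; have [[Chy _]|[_ hy0]] := hP y; last by rewrite /= hy0 -hx h0.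
  by case: nCy; exists (h y).
have /finite_seqP[s hs] := locally_constant_finite_range imX oh.
exists (\max_(n <- s) n).+1; apply/seteqP; split=> [x [n _ Cn]|x [n _ Cn]]; last by exists n.
have [[Chx _]|[/(_ n)//]] := hP x.
exists (h x) => //=; rewrite ltnS.
by apply: (@leq_bigmax_seq _ s xpredT id) => //; have : range h (h x) by []; rewrite hs.
Qed.

(** * A closed curve in the plane *)

Lemma hausdorff_separating (Y Z : topologicalType) :
    hausdorff_space Z ->
    (forall x y : Y, x <> y -> exists2 f : Y -> Z, continuous f & f x <> f y) ->
  hausdorff_space Y.
Proof.
move=> hZ sep x y xy; apply: contrapT => /sep[f cf fxy]; apply: fxy; apply: hZ.
move=> A B fxA fyB; have [z [Az Bz]] := xy _ _ (cf _ _ fxA) (cf _ _ fyB).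
by exists (f z).
Qed.

Section Loop.
Local Open Scope ring_scope.
Import Order.TTheory GRing.Theory Num.Theory.
Import numFieldNormedType.Exports.
Context (R : realType).

(** The closed loop of the nodal cubic y^2 = x^2 (1 - 4 x), run through once on [0, 1], from the
    node back to the node. *)
Definition loop (t : R) : R * R := (t * (1 - t), t * (1 - t) * (1 - 2 * t)).

(* The ratio of the two coordinates determines [t] away from the node. *)
Lemma loop_inj (s t : R) : 0 < s < 1 -> 0 <= t <= 1 -> loop s = loop t -> s = t.
Proof.
move=> s01 t01 [e1 e2].
have : s * (1 - s) * (s - t) = 0.
  by rewrite -e1 in e2; move: e2; move: (s * (1 - s)) => a; nra.
move=> /eqP; rewrite !mulf_eq0 !subr_eq0 => /orP[/orP[]|] /eqP //; lra.
Qed.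

Lemma loop_continuous : continuous loop.
Proof.
have c2 : continuous (fun t : R => t * (1 - t)).
  by move=> t; apply: cvgM => //; apply: cvgB => //; exact: cvg_cst.
have c3 : continuous (fun t : R => t * (1 - t) * (1 - 2 * t)).
  move=> t; apply: cvgM; first exact: c2.
  by apply: cvgB; [exact: cvg_cst|apply: cvgM => //; exact: cvg_cst].
by move=> t; exact: cvg_pair (c2 t) (c3 t).
Qed.

(** The retraction of the line onto [0, 1], written with absolute values so that its continuity is
    immediate; the curve is then parametrised by all of [R]. *)
Definition unit_clamp (t : R) : R := (`|t| - `|t - 1| + 1) / 2.

Lemma unit_clamp_continuous : continuous unit_clamp.
Proof.
move=> t; apply: cvgM; last exact: cvg_cst.
apply: cvgD; last exact: cvg_cst.
by apply: cvgB; apply: cvg_norm => //; apply: cvgB => //; exact: cvg_cst.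
Qed.

Lemma unit_clampP t : 0 <= unit_clamp t <= 1.
Proof.
rewrite /unit_clamp; case: (ger0P t) => t0; case: (ger0P (t - 1)) => t1; lra.
Qed.

Lemma unit_clamp_id t : 0 <= t <= 1 -> unit_clamp t = t.
Proof.
by move=> t01; rewrite /unit_clamp ger0_norm ?ler0_norm; lra.
Qed.

Definition loop_curve : set (R * R) := range (loop \o unit_clamp).

Definition loop_point (t : R) : loop_curve :=
  SigSub (mem_set (imageT (loop \o unit_clamp) t)).

Lemma loop_point_continuous : continuous loop_point.
Proof.
apply: continuous_comp_initial => t.
apply: (@continuous_comp _ _ _ unit_clamp loop); first exact: unit_clamp_continuous.
exact: loop_continuous.
Qed.

Lemma loop_point_surj (y : loop_curve) : exists2 t, 0 <= t <= 1 & loop_point t = y.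
Proof.
case: y => y yP; have /set_mem[t _ ty] := yP.
exists (unit_clamp t); first exact: unit_clampP.
apply: val_inj => /=; rewrite -ty /= (unit_clamp_id (unit_clampP t)).
by [].
Qed.

Lemma loop_point_inj (s t : R) :
  0 < s < 1 -> 0 <= t <= 1 -> loop_point s = loop_point t -> s = t.
Proof.
move=> s01 t01 /(congr1 val) /=; rewrite !unit_clamp_id//; first exact: loop_inj.
by case/andP: s01 => *; rewrite !ltW.
Qed.

Lemma loop_point_node : loop_point 0 = loop_point 1.
Proof.
apply: val_inj; rewrite /= !unit_clamp_id ?lexx ?ler01//.
by rewrite /loop; congr (_, _); ring.
Qed.

Lemma loop_curve_hausdorff : hausdorff_space loop_curve.
Proof.
apply: (hausdorff_separating (@Rhausdorff R)) => x y xy.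
have vc : continuous (set_val : loop_curve -> R * R).
  apply: (@initial_continuous loop_curve (R * R)%type set_val).
have [e1|n1] := eqVneq (val x).1 (val y).1; last first.
  exists (fst \o set_val); last exact/eqP.
  by move=> z; apply: continuous_comp; [exact: vc|exact: cvg_fst].
have [e2|n2] := eqVneq (val x).2 (val y).2; last first.
  exists (snd \o set_val); last exact/eqP.
  by move=> z; apply: continuous_comp; [exact: vc|exact: cvg_snd].
by case: xy; apply: val_inj; rewrite [LHS]surjective_pairing e1 e2 -surjective_pairing.
Qed.


(** The two open rays at [q] partition the remaining points, which form a connected set, so one of
    the rays is empty. *)
Lemma loop_curve_minus_point (lt : loop_curve -> loop_curve -> Prop) (q : loop_curve) :
    order_generated lt ->
  (forall y, y <> q -> lt y q) \/ (forall y, y <> q -> lt q y).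
Proof.
move=> og.
have olt : open [set y | lt y q].
  by rewrite openE => y /= yq; apply/(og_nbhs og); exists y, q => z [_]; apply.
have ogt : open [set y | lt q y].
  by rewrite openE => y /= yq; apply/(og_nbhs og); exists q, y => z [+ _]; apply.
have side (I : set R) : is_interval I -> (forall s, I s -> loop_point s <> q) ->
    forall s t, I s -> I t -> lt (loop_point s) q -> lt (loop_point t) q.
  move=> /connected_intervalP cI Iq s t Is It sq.
  suff E : I `&` (loop_point @^-1` [set y | lt y q]) = I by move: It; rewrite -E => -[].
  have lp (U : set loop_curve) : open U -> open (loop_point @^-1` U).
    by move: U; apply/continuousP; exact: loop_point_continuous.
  apply: cI; first by exists s.
    by exists (loop_point @^-1` [set y | lt y q]) => //; exact: lp.
  exists (~` (loop_point @^-1` [set y | lt q y])).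
    by apply: open_closedC; exact: lp.
  apply/seteqP; split=> r [Ir rq]; split=> //=.
    by move=> qr; exact: (og_irr og (og_trans og rq qr)).
  by case: (og_total og (loop_point r) q) => // /Iq -/(_ Ir).
suff sides y z : y <> q -> z <> q -> lt y q -> lt z q.
  have [[y [yq ylt]]|n] := pselect (exists y, y <> q /\ lt y q).
    by left=> z zq; exact: sides yq zq ylt.
  right=> z zq; case: (og_total og z q) => // zq'; case: n.
  by exists z.
move=> yq zq.
have [t t01 tq] := loop_point_surj q.
have [s s01 sy] := loop_point_surj y; have [r r01 rz] := loop_point_surj z.
have [t0|/andP[t0 t1]] : (t = 0 \/ t = 1) \/ 0 < t < 1.
  have [->|t0] := eqVneq t 0; first by left; left.
  have [->|t1] := eqVneq t 1; first by left; right.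
  by right; rewrite lt_def t0 lt_neqAle t1.
  (* Here [q] is the node, and the rest of the curve is the image of the open interval (0, 1). *)
  have q0 : q = loop_point 0 by rewrite -tq; case: t0 => ->//; rewrite loop_point_node.
  have q1 : q = loop_point 1 by rewrite q0 loop_point_node.
  have in01 s' x : 0 <= s' <= 1 -> loop_point s' = x -> x <> q -> 0 < s' < 1.
    move=> s01' <- sq'; rewrite !lt_def; case/andP: s01' => -> ->; rewrite !andbT.
    by apply/andP; split; apply/eqP => e; apply: sq'; [rewrite e q0|rewrite -e q1].
  rewrite -sy -rz.
  apply: (side [set x | 0 < x < 1]); [| |exact: in01 sy _|exact: in01 rz _].
    by move=> a b /andP[? ?] /andP[? ?] c /andP[? ?] /=; lra.
  move=> x /= x01 xq; have := @loop_point_inj x 0 x01.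
  rewrite lexx ler01 => /(_ isT); rewrite xq -q0 => /(_ erefl) x0.
  by rewrite x0 ltxx in x01.
have tne s' : 0 <= s' <= 1 -> loop_point s' <> q -> s' != t.
  by move=> s01' sq; apply/eqP => e; apply: sq; rewrite e.
have nq s' : 0 <= s' <= 1 -> s' != t -> loop_point s' <> q.
  move=> s01' s't e; move: s't; rewrite (@loop_point_inj t s') ?eqxx ?t0//.
  by rewrite tq e.
pose node := loop_point 0.
(* Away from the node, the rest is the image of [0, t) and of (t, 1], two arcs that share the node
   as the image of 0 and of 1; each point is therefore compared with the node. *)
have toward s' : 0 <= s' <= 1 -> s' != t ->
    (lt (loop_point s') q <-> lt node q).
  move=> s01'; rewrite neq_lt => /orP[st|ts].
    have [i1 i2] : is_interval [set x | 0 <= x < t] /\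
        (forall x, 0 <= x < t -> loop_point x <> q).
      split=> [a b /andP[? ?] /andP[? ?] c /andP[? ?] /=|x x0t]; first lra.
      by have /andP[_ xt] := x0t; apply: nq; [lra|rewrite lt_eqF].
    by split; apply: (side _ i1 i2) => /=; lra.
  have [i1 i2] : is_interval [set x | t < x <= 1] /\
      (forall x, t < x <= 1 -> loop_point x <> q).
    split=> [a b /andP[? ?] /andP[? ?] c /andP[? ?] /=|x x0t]; first lra.
    by have /andP[tx _] := x0t; apply: nq; [lra|rewrite gt_eqF].
  by rewrite /node loop_point_node; split; apply: (side _ i1 i2) => /=; lra.
rewrite -sy -rz => syq; apply/toward => //.
  by apply: tne => //; rewrite rz.
by apply/(toward s) => //; apply: tne => //; rewrite sy.
Qed.

(** A linear order has at most two endpoints, whereas each of three distinct points of the curve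
    would be one. *)
Lemma loop_curve_not_LOTS : ~ LOTS loop_curve.
Proof.
move=> /LOTS_order[lt og].
have ne (s t : R) : 0 < s < 1 -> 0 <= t <= 1 -> s != t -> loop_point s <> loop_point t.
  by move=> s01 t01 /eqP st /loop_point_inj; auto.
have [ab ac bc] : [/\ loop_point (1/2) <> loop_point (1/3),
    loop_point (1/2) <> loop_point 0 & loop_point (1/3) <> loop_point 0].
  by split; (apply: ne; [lra|lra|apply/eqP => e; lra]).
move: (loop_point _) (loop_point _) (loop_point _) ab ac bc => a b c ab ac bc.
have ab' := nesym ab; have ac' := nesym ac; have bc' := nesym bc.
have [irr tr _ _] := og.
case: (loop_curve_minus_point a og) => Ha; case: (loop_curve_minus_point b og) => Hb;
  case: (loop_curve_minus_point c og) => Hc;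
  solve [apply: (irr a); apply: (tr _ b); auto|apply: (irr a); apply: (tr _ c); auto
        |apply: (irr b); apply: (tr _ c); auto].
Qed.

Lemma no_continuous_unit_surjection (X : topologicalType) (u : X -> R) :
    image_LOTS X -> continuous u -> (forall t, 0 <= t <= 1 -> exists x, u x = t) ->
  False.
Proof.
move=> imX cu su; apply: loop_curve_not_LOTS; apply: imX.
split; first exact: loop_curve_hausdorff.
exists (loop_point \o u).
  by move=> x; apply: continuous_comp; [exact: cu|exact: loop_point_continuous].
apply/seteqP; split=> // y _; have [t /su[x ux] <-] := loop_point_surj y.
by exists x => //=; rewrite ux.
Qed.

End Loop.

(** * Scatteredness *)

Section DyadicMap.
Local Open Scope ring_scope.
Import Order.TTheory GRing.Theory Num.Theory.
Context (R : realType) (X : Type) (lt S : X -> X -> Prop).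
Hypothesis lt_irr : forall x, ~ lt x x.
Hypothesis lt_trans : forall x y z, lt x y -> lt y z -> lt x z.
Hypothesis S_lt : forall x y, S x y -> lt x y.

Section Embedding.
Context (mid : X -> X -> X) (a b : X).
Hypothesis S_mid : forall x y, S x y -> S x (mid x y) /\ S (mid x y) y.
Hypothesis S_ab : S a b.

(** [dyadic n k] stands for the dyadic number k / 2^n with k <= 2^n: refining a level keeps the old
    points at even places and puts midpoints at odd ones. *)
Fixpoint dyadic (n k : nat) : X :=
  if n is n'.+1 then
    if odd k then mid (dyadic n' k./2) (dyadic n' k./2.+1) else dyadic n' k./2
  else if k is 0%N then a else b.

Lemma dyadic_step n k : (k < 2 ^ n)%N -> S (dyadic n k) (dyadic n k.+1).
Proof.
elim: n k => [|n IH] k; first by case: k.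
rewrite expnS mul2n => kn; have /IH/S_mid[Sl Sr] : (k./2 < 2 ^ n)%N.
  by rewrite ltn_half_double.
rewrite /= uphalf_half; case: ifP => ok; rewrite ?add1n ?add0n //= ok.
Qed.

Lemma dyadic_lt n i j : (i < j)%N -> (j <= 2 ^ n)%N -> lt (dyadic n i) (dyadic n j).
Proof.
elim: j => // j IH; rewrite ltnS leq_eqVlt => /orP[/eqP->|ij] jn.
  exact/S_lt/dyadic_step.
by apply: lt_trans (IH ij (ltnW jn)) _; exact/S_lt/dyadic_step.
Qed.

Lemma dyadic_lift m n i : dyadic (m + n) (i * 2 ^ m) = dyadic n i.
Proof.
elim: m => [|m IH]; first by rewrite expn0 muln1.
by rewrite addSn /= expnS mulnCA mul2n odd_double doubleK.
Qed.

Lemma dyadic_ltP m n i j : (i <= 2 ^ m)%N -> (i * 2 ^ n < j * 2 ^ m)%N ->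
  (j <= 2 ^ n)%N -> lt (dyadic m i) (dyadic n j).
Proof.
move=> im ij jn; rewrite -(dyadic_lift n m) -(dyadic_lift m n) [(m + n)%N]addnC.
by apply: dyadic_lt => //; rewrite expnD leq_mul2r jn orbT.
Qed.

(** The value 0 keeps the set nonempty for points below [a]. *)
Definition dyadic_values (x : X) : set R :=
  [set r | r = 0 \/ exists n i, [/\ (i <= 2 ^ n)%N, ~ lt x (dyadic n i) &
                                  r = i%:R / 2 ^+ n]].

Definition dyadic_map (x : X) : R := sup (dyadic_values x).

Lemma dyadic_values_ub x : ubound (dyadic_values x) 1.
Proof.
move=> r [->//|[n [i [ni _ ->]]]].
by rewrite ler_pdivrMr ?exprn_gt0// mul1r -natrX ler_nat.
Qed.

Lemma dyadic_values_sup x : has_sup (dyadic_values x).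
Proof. by split; [exists 0; left|exists 1; exact: dyadic_values_ub]. Qed.

Lemma dyadic_map_ge0 x : 0 <= dyadic_map x.
Proof. by apply: ub_le_sup; [case: (dyadic_values_sup x)|left]. Qed.

Lemma dyadic_map_le1 x : dyadic_map x <= 1.
Proof. by apply: ge_sup; [case: (dyadic_values_sup x)|exact: dyadic_values_ub]. Qed.

Lemma dyadic_map_mono x y : lt x y -> dyadic_map x <= dyadic_map y.
Proof.
move=> xy; apply: ge_sup; first by case: (dyadic_values_sup x).
move=> r xr; apply: ub_le_sup; first by case: (dyadic_values_sup y).
case: xr => [->|[n [i [ni xi ->]]]]; [by left|right; exists n, i; split=> // yi].
by apply: xi; exact: lt_trans xy yi.
Qed.

Lemma dyadic_mapE n i : (i <= 2 ^ n)%N -> dyadic_map (dyadic n i) = i%:R / 2 ^+ n.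
Proof.
move=> ni; apply/eqP; rewrite eq_le; apply/andP; split; last first.
  by apply: ub_le_sup; [case: (dyadic_values_sup (dyadic n i))|right; exists n, i; split].
apply: ge_sup; first by case: (dyadic_values_sup (dyadic n i)).
move=> r [->|[m [j [mj ji ->]]]]; first by rewrite divr_ge0// exprn_ge0.
rewrite ler_pdivrMr ?exprn_gt0// mulrAC ler_pdivlMr ?exprn_gt0//.
rewrite -!natrX -!natrM ler_nat leqNgt; apply/negP => ij.
by apply: ji; apply: dyadic_ltP.
Qed.

Lemma dyadic_map_dense s t : 0 <= s -> s < t -> t <= 1 ->
  exists x, s < dyadic_map x < t.
Proof.
move=> s0 st t1; have [k kst] := ltr_add_invr st.
(* Since 1 / 2^n <= 1 / (k + 1) < t - s, the first multiple of 1 / 2^n beyond [s] is still below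
   [t]; [i] is its numerator. *)
pose n := k.+1; pose i := (Num.trunc (s * 2 ^+ n)).+1.
have p0 : 0 < 2 ^+ n :> R by rewrite exprn_gt0.
have /andP[iles silt] : (Num.trunc (s * 2 ^+ n))%:R <= s * 2 ^+ n < i%:R.
  by apply: trunc_itv; rewrite mulr_ge0 // ltW.
have ist : i%:R / 2 ^+ n < t.
  apply: le_lt_trans kst; rewrite ler_pdivrMr// mulrDl /i -natr1 lerD//.
  rewrite mulrC ler_pdivlMr// mul1r -natrX ler_nat ltnW//.
  exact: ltn_expl.
have ni : (i <= 2 ^ n)%N.
  rewrite -(ler_nat R) natrX -[leRHS]mul1r -ler_pdivrMr//.
  by apply: le_trans t1; exact: ltW.
by exists (dyadic n i); rewrite dyadic_mapE// ist andbT ltr_pdivlMr.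
Qed.

End Embedding.

Lemma monotone_dense_map :
    (forall x y, S x y -> exists z, S x z /\ S z y) -> (exists x y, S x y) ->
  exists f : X -> R, [/\ forall x, 0 <= f x <= 1, forall x y, lt x y -> f x <= f y &
    forall s t, 0 <= s -> s < t -> t <= 1 -> exists x, s < f x < t].
Proof.
move=> Sdense [a [b Sab]].
have /choice[mid midP] : forall p : X * X, exists z, S p.1 p.2 -> S p.1 z /\ S z p.2.
  move=> [x y] /=; have [/Sdense[z]|nS] := pselect (S x y); first by exists z.
  by exists x.
pose m x y := mid (x, y).
have mP x y : S x y -> S x (m x y) /\ S (m x y) y by exact: (midP (x, y)).
exists (dyadic_map m a b); split.
- by move=> x; rewrite dyadic_map_ge0 dyadic_map_le1.
- exact: dyadic_map_mono.
- exact: dyadic_map_dense.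
Qed.

End DyadicMap.

Section Scattered.
Local Open Scope ring_scope.
Import Order.TTheory GRing.Theory Num.Theory.
Import numFieldNormedType.Exports.
Context (R : realType) (X : topologicalType) (lt : X -> X -> Prop).
Hypothesis og : order_generated lt.

(** A monotone map with dense values has no jumps: values close to [f x] on either side provide the
    endpoints of an order box. *)
Lemma monotone_dense_continuous (f : X -> R) :
    (forall x, 0 <= f x <= 1) -> (forall x y, lt x y -> f x <= f y) ->
    (forall s t, 0 <= s -> s < t -> t <= 1 -> exists x, s < f x < t) ->
  continuous f.
Proof.
move=> f01 fmono fdense x; apply/cvgrPdist_lt => e e0.
have [a aP] : exists a, forall z, (lt a x -> lt a z) -> f x - e < f z.
  have [[y /andP[yl yx]]|ny] := pselect (exists y, f x - e < f y < f x).
    exists y => z yz; apply: (lt_le_trans yl); apply/fmono/yz.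
    case: (og_total og y x) => // [yx'|/fmono xy]; first by rewrite yx' ltxx in yx.
    by move: yx; rewrite ltNge xy.
  (* The endpoint [x] imposes no condition: by density, any [z] with [f z <= f x - e] would produce
     a value in the gap just excluded. *)
  exists x => z _; rewrite ltNge; apply/negP => zx; apply: ny.
  have /andP[z0 _] := f01 z; have /andP[_ x1] := f01 x.
  by apply: fdense => //; [exact: le_trans z0 zx|rewrite ltrBlDr ltrDl].
have [b bP] : exists b, forall z, (lt x b -> lt z b) -> f z < f x + e.
  have [[y /andP[xy yl]]|ny] := pselect (exists y, f x < f y < f x + e).
    exists y => z yz; apply: le_lt_trans yl; apply/fmono/yz.
    case: (og_total og y x) => // [/fmono yx|yx']; last by rewrite yx' ltxx in xy.
    by move: xy; rewrite ltNge yx.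
  exists x => z _; rewrite ltNge; apply/negP => zx; apply: ny.
  have /andP[_ z1] := f01 z; have /andP[x0 _] := f01 x.
  by apply: fdense => //; [rewrite ltrDl|exact: le_trans zx z1].
have : nbhs x (order_box lt x a b) by apply/(og_nbhs og); exists a, b.
apply: filterS => z [/aP za /bP zb].
by rewrite /= ltr_norml; lra.
Qed.

(** If the range contains a segment, rescaling it gives the excluded surjection. Otherwise every
    segment contains a missing value, and cuts at missing values are clopen. *)
Lemma no_monotone_dense_map (f : X -> R) :
    image_LOTS X ->
    (forall x, 0 <= f x <= 1) -> (forall x y, lt x y -> f x <= f y) ->
    (forall s t, 0 <= s -> s < t -> t <= 1 -> exists x, s < f x < t) ->
  False.
Proof.
move=> imX f01 fmono fdense; have cf := monotone_dense_continuous f01 fmono fdense.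
have [[s [t [[s0 st t1] full]]]|nofull] := pselect (exists s t, [/\ 0 <= s, s < t & t <= 1] /\
    forall r, s <= r <= t -> exists x, f x = r).
  apply: (@no_continuous_unit_surjection R X (fun x => (f x - s) / (t - s))) => //.
    move=> x; apply: cvgM; last exact: cvg_cst.
    by apply: cvgB; [exact: cf|exact: cvg_cst].
  have st0 : 0 < t - s by rewrite subr_gt0.
  move=> r r01; have [|x fx] := full (s + r * (t - s)); first nra.
  by exists x; rewrite fx addrAC subrr add0r mulfK// gt_eqF.
have gap s t : 0 <= s -> s < t -> t <= 1 -> exists r, s <= r <= t /\ forall x, f x <> r.
  move=> s0 st t1; apply: contrapT => nr; apply: nofull; exists s, t; split=> // r rst.
  by apply: contrapT => nx; apply: nr; exists r; split=> // x fx; apply: nx; exists x.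
have cut r : (forall x, f x <> r) -> clopen [set x | f x < r].
  move=> nr; split; first by apply: open_comp (@open_lt _ r) => x _; exact: cf.
  rewrite (_ : [set x | f x < r] = f @^-1` [set y | y <= r]).
    by apply: preimage_closed; [move=> x _; exact: cf|exact: (@closed_le _ r)].
  apply/seteqP; split=> x /=; first exact: ltW.
  by rewrite le_eqVlt => /orP[/eqP/nr|].
have [|||t [/andP[t2 t1] nt]] := gap (1/2) 1; [lra|lra|lra|].
have t0 : 0 < t by lra.
have inv_lt n : t - t / n.+1%:R < t - t / n.+2%:R.
  by rewrite ltrD2l ltrN2 ltr_pM2l// ltf_pV2 ?posrE// ltr_nat.
(* Missing values [s n] taken in consecutive segments that tend to the missing value [t], so that
   the cuts at [s n] exhaust the clopen cut at [t]. *)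
have /choice[s sP] : forall n : nat, exists r,
    t - t / n.+1%:R <= r <= t - t / n.+2%:R /\ forall x, f x <> r.
  move=> n; apply: gap => //.
    by rewrite subr_ge0 ler_pdivrMr// ler_peMr ?ler1n// ltW.
  by apply: le_trans t1; rewrite gerBl divr_ge0// ltW.
have CU : \bigcup_n [set x | f x < s n] = [set x | f x < t].
  apply/seteqP; split=> [x [n _ /= fs]|x /= ft].
    apply: lt_le_trans fs _; have [/andP[_ sn] _] := sP n; apply: le_trans sn _.
    by rewrite gerBl divr_ge0// ltW.
  have xt : 0 < (t - f x) / t by rewrite divr_gt0// subr_gt0.
  have [k] := ltr_add_invr xt; rewrite add0r => kx; exists k => //=.
  have [/andP[sk _] _] := sP k; apply: lt_le_trans sk.
  by rewrite ltrBrDl -ltrBrDr -ltr_pdivlMl// mulrC.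
have [||N CN] := @clopen_bigcup_finite X (fun n => [set x | f x < s n]) imX.
- by move=> n; apply: cut; case: (sP n).
- by rewrite CU; case: (cut t nt).
(* For [n < N] each [s n] is at most t - t / (N + 1), so density gives a point of the cut at [t]
   outside the first [N] cuts. *)
have [|||x /andP[xl xt]] := fdense (t - t / N.+1%:R) t.
- by rewrite subr_ge0 ler_pdivrMr// ler_peMr ?ler1n// ltW.
- by rewrite gtrBl divr_gt0.
- exact: t1.
have : [set x | f x < t] x by [].
rewrite -CU CN => -[n /= nN fs]; move: xl; rewrite ltNge => /negP; apply.
apply: le_trans (ltW fs) _; have [/andP[_ sn] _] := sP n; apply: le_trans sn _.
by rewrite lerD2l lerN2 ler_pM2l// lef_pV2 ?posrE// ler_nat.
Qed.

End Scattered.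

Lemma exists_isolated_point (X : topologicalType) (lt : X -> X -> Prop) (P : set X) :
    order_generated lt -> image_LOTS X -> P !=set0 ->
  exists2 x, P x & exists2 U, nbhs x U & P `&` U `<=` [set x].
Proof.
move=> og imX [p0 Pp0]; apply: contrapT => niso.
have other p U : P p -> nbhs p U -> exists q, [/\ P q, U q & q <> p].
  move=> Pp nU; apply: contrapT => nq; apply: niso; exists p => //; exists U => //.
  by move=> q [Pq Uq]; apply: contrapT => qp; apply: nq; exists q.
have [irr tr tot nb] := og.
pose S a b := exists p, [/\ P p, lt a p & lt p b].
(* The middle one of three points of [P] in an interval witnesses the density of [S]: [P] meets the
   interval on both sides of it. *)
have three a b p : P p -> nbhs p (order_box lt p a b) ->
    exists x y z, [/\ P x, P y, P z, lt x y & lt y z] /\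
    [/\ order_box lt p a b x, order_box lt p a b y & order_box lt p a b z].
  move=> Pp np; have pbox : order_box lt p a b p by split.
  have [q [Pq qbox qp]] := other p _ Pp np.
  (* The box with both endpoints [q] is the side of [q] that contains [p], so the new point [r]
     differs from [q] as well as from [p]. *)
  have : nbhs p (order_box lt p a b `&` order_box lt p q q).
    by apply: filterI => //; apply/nb; exists q, q.
  move=> /(other p _ Pp)[r [Pr [rbox [rl rr]] rp]].
  case: (tot p q) => [pq|/esym//|qp'].
    by case: (tot p r) => [pr|/esym//|rp']; [exists p, r, q|exists r, p, q];
      do 2 split => //; exact: rr.
  by case: (tot p r) => [pr|/esym//|rp']; [exists q, p, r|exists q, r, p];
    do 2 split => //; exact: rl.
have [|||||f [f01 fmono fdense]] := @monotone_dense_map Rdefinitions.R X lt S.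
- exact: irr.
- exact: tr.
- by move=> x y [p [_ xp]]; exact: tr.
- move=> a b [p [Pp ap pb]].
  have np : nbhs p (order_box lt p a b) by apply/nb; exists a, b.
  have [x [y [z [[Px Py Pz xy yz] [[xa xb] [ya yb] [za zb]]]]]] := three a b p Pp np.
  by exists y; split; [exists x|exists z]; split=> //; auto.
- have np0 : nbhs p0 (order_box lt p0 p0 p0) by apply/nb; exists p0, p0.
  have [x [y [z [[_ Py _ xy yz] _]]]] := three p0 p0 p0 Pp0 np0.
  by exists x, z, y.
exact: no_monotone_dense_map og f imX f01 fmono fdense.
Qed.

(** * Compactness *)

Lemma open_ray (X : topologicalType) (lt : X -> X -> Prop) (b : X) :
  order_generated lt -> open [set y | lt y b].
Proof.
move=> og; rewrite openE => y /= yb; apply/(og_nbhs og).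
by exists y, b => z [_]; apply.
Qed.

Lemma clopen_initial_segment (X : topologicalType) (lt : X -> X -> Prop) (d : X) :
  order_generated lt -> open [set d] -> clopen [set y | ~ lt d y].
Proof.
move=> og od; split; last exact/open_closedC/(open_ray _ (order_generated_flip og)).
rewrite (_ : mkset _ = [set y | lt y d] `|` [set d]); first exact/openU/od/open_ray.
apply/seteqP; split=> [y /= ndy|y [yd dy|-> /(og_irr og)//]].
  by case: (og_total og y d) => [yd|->|//]; [left|right].
exact: (og_irr og (og_trans og yd dy)).
Qed.

(** Indices that code no element of [D] get the empty set, so [D] may be finite or empty. *)
Lemma countable_clopen_sequence (X : topologicalType) (I : Type) (D : set I)
    (C : I -> set X) : countable D -> (forall d, D d -> clopen (C d)) ->
  exists V : nat -> set X, [/\ forall n, clopen (V n),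
    forall n, V n = set0 \/ exists2 d, D d & V n = C d &
    \bigcup_n V n = \bigcup_(d in D) C d].
Proof.
move=> /countable_injP[f finj] oC.
have /choice[V VP] : forall n, exists V, (exists d, [/\ D d, f d = n & V = C d]) \/
    (V = set0 /\ forall d, D d -> f d <> n).
  move=> n; have [[d [Dd dn]]|nd] := pselect (exists d, D d /\ f d = n).
    by exists (C d); left; exists d.
  by exists set0; right; split=> // d Dd dn; apply: nd; exists d.
exists V; split=> [n|n|].
- by case: (VP n) => [[d [Dd _ ->]]|[-> _]]; [exact: oC|exact: clopen0].
- by case: (VP n) => [[d [Dd _ ->]]|[-> _]]; [right; exists d|left].
apply/seteqP; split=> [x [n _]|x [d Dd Cx]].
  by case: (VP n) => [[d [Dd _ ->]] Cx|[-> _]//]; exists d.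
exists (f d) => //; case: (VP (f d)) => [[d' [Dd' dd' ->]]|[_ /(_ _ Dd)//]].
by rewrite (finj d' d) ?inE.
Qed.

Section CompactLOTS.
Context (X : topologicalType) (hX : hausdorff_space X) (imX : image_LOTS X).

(** The open interval from [a] to [c] has a relatively isolated point; the interval being open, that
    point is isolated in [X]. *)
Lemma isolated_point_between (lt : X -> X -> Prop) (a b c : X) :
    order_generated lt -> lt a b -> lt b c ->
  exists d, [/\ open [set d], lt a d & lt d c].
Proof.
move=> og ab bc; pose P := [set y | lt a y] `&` [set y | lt y c].
have oP : open P.
  apply: openI; last exact: open_ray.
  exact: open_ray (order_generated_flip og).
have [|d [ad dc] [U nU PU]] := exists_isolated_point (P := P) og imX; first by exists b.
exists d; split=> //; rewrite openE => _ ->.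
by apply: filterS PU _; apply: filterI => //; exact: open_nbhs_nbhs.
Qed.

(** [A] is closed since its complement has no least element, and it is the union of the clopen
    segments ending at its isolated points. Finitely many of these would suffice, although [A] has
    no greatest element. *)
Lemma no_gap (lt : X -> X -> Prop) (A : set X) :
    order_generated lt -> A !=set0 ->
    (forall x y, A x -> lt y x -> A y) ->
    (forall x, A x -> exists2 y, A y & lt x y) ->
    (forall x, ~ A x -> exists2 y, ~ A y & lt y x) ->
  False.
Proof.
move=> og A0 Adown Amax Bmin; have [irr tr tot nb] := og.
pose D := [set d | open [set d]] `&` A.
pose C (d : X) := [set y | ~ lt d y].
have [|d [od _]|V [oV VP VU]] := @countable_clopen_sequence X X D C.
- apply: sub_countable (countable_isolated_points hX imX).
  by apply: subset_card_le => x [].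
- exact: clopen_initial_segment.
have UA : \bigcup_(d in D) C d = A.
  apply/seteqP; split=> [y [d [_ Ad] /= ndy]|y Ay].
    by case: (tot y d) => [|->//|//]; exact: Adown.
  have [a Aa ya] := Amax _ Ay; have [b Ab ab] := Amax _ Aa.
  have [d [od yd db]] := isolated_point_between og ya ab.
  exists d; first by split=> //; exact: Adown db.
  by move=> /(tr _ _ _ yd)/irr.
have cA : closed A.
  rewrite -openC openE => y /Bmin[z nAz zy].
  apply/nb; exists z, z => w [/(_ zy) zw _] Aw; exact/nAz/(Adown w).
have [|N VN] := clopen_bigcup_finite imX oV; first by rewrite VU UA.
have Vdown n x y : V n x -> lt y x -> V n y.
  case: (VP n) => [->//|[d _ ->]] /= ndx yx dy; exact: ndx (tr _ _ _ dy yx).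
(* Beyond the first [N] segments there is still a point of [A]. *)
have : exists2 a, A a & forall n, n < N -> ~ V n a.
  elim: (N) => [|M [a Aa aM]]; first by case: A0 => a Aa; exists a.
  have [b Ab [ab Vb]] : exists2 b, A b & (~ lt b a) /\ ~ V M b.
    case: (VP M) => [->|[d [_ Ad] ->]]; first by exists a => //; split=> //; exact: irr.
    case: (tot a d) => [ad|ad|da].
    - have [b Ab db] := Amax _ Ad; exists b => //; split; last by move=> /(_ db).
      by move=> ba; exact: irr (tr _ _ _ (tr _ _ _ ad db) ba).
    - have [b Ab db] := Amax _ Ad; exists b => //; split; last by move=> /(_ db).
      by rewrite ad => /(tr _ _ _ db)/irr.
    - by exists a => //; split=> [/irr//|/(_ da)].
  exists b => // n; rewrite ltnS leq_eqVlt => /orP[/eqP->//|nM] Vnb.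
  by case: (tot a b) => [/(Vdown _ _ _ Vnb)|eab|//]; [exact: aM|apply: aM nM _; rewrite eab].
move=> [a Aa aN]; move: Aa; rewrite -UA -VU VN => -[n /= nN]; exact: aN.
Qed.

Lemma image_LOTS_compact (lt : X -> X -> Prop) :
  order_generated lt -> compact [set: X].
Proof.
move=> og; have [irr tr tot nb] := og; rewrite compact_ultra => F UF FT.
(* The cut defined by the ultrafilter [F], which converges to the greatest element of [A] or to the
   least one of the complement; [no_gap] excludes that both are missing. *)
pose A := [set x | F [set y | ~ lt y x]].
have nA x : ~ A x -> F [set y | lt y x].
  move=> nAx; have [//|] := in_ultra_setVsetC [set y | lt y x] UF.
  by move=> /nAx.
have Adown x y : A x -> lt y x -> A y.
  by move=> Ax yx; apply: filterS Ax => z nzx zy; exact: nzx (tr _ _ _ zy yx).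
have conv s : (forall a, lt a s -> F [set y | lt a y]) ->
    (forall b, lt s b -> F [set y | lt y b]) -> F --> s.
  move=> sa sb U /nb[a [b boxU]]; apply: filterS boxU _.
  apply: filterI.
    by have [/sa|nas] := pselect (lt a s); [apply: filterS|apply: filterS FT].
  by have [/sb|nsb] := pselect (lt s b); [apply: filterS|apply: filterS FT].
have [[s [As smax]]|Amax] := pselect (exists s, A s /\ forall x, A x -> ~ lt s x).
  exists s; split=> //; apply: conv => [a as_|b sb].
    by apply: filterS As => y nys; case: (tot y s) => [//|->//|]; exact: tr.
  by apply: nA => /smax.
have {}Amax x : A x -> exists2 y, A y & lt x y.
  move=> Ax; apply: contrapT => nx; apply: Amax; exists x; split=> // y Ay xy.
  by apply: nx; exists y.
have [[s [nAs smin]]|Bmin] := pselect (exists s, ~ A s /\ forall x, ~ A x -> ~ lt x s).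
  exists s; split=> //; apply: conv => [a as_|b sb].
    have Aa : A a by apply: contrapT => /smin.
    have [b Ab ab] := Amax _ Aa.
    by apply: filterS Ab => y nyb; case: (tot y b) => [//|->//|]; exact: tr.
  by apply: filterS (nA _ nAs) => y ys; exact: tr sb.
have {}Bmin x : ~ A x -> exists2 y, ~ A y & lt y x.
  move=> nAx; apply: contrapT => nx; apply: Bmin; exists x; split=> // y nAy yx.
  by apply: nx; exists y.
exfalso; have [x _] := filter_ex FT.
(* [no_gap] wants a nonempty lower set; if [x] is not in [A], the complement is one for the reversed
   order. *)
have [Ax|nAx] := pselect (A x); first by apply: (no_gap og _ Adown Amax Bmin); exists x.
apply: (no_gap (order_generated_flip og) (A := ~` A)) => //.
- by exists x.
- by move=> y z nAy yz Az; apply: nAy; exact: Adown yz.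
- by move=> y; rewrite /setC /= notK => /Amax[z Az yz]; exists z => //; rewrite notK.
Qed.

(** If the ray below [x] is closed, it is itself clopen. Otherwise it has no greatest element, and
    the segments ending at isolated points below [x] exhaust it. *)
Lemma clopen_sequence_below (lt : X -> X -> Prop) (x : X) :
    order_generated lt ->
  exists2 V : nat -> set X, forall n, clopen (V n) & \bigcup_n V n = [set y | lt y x].
Proof.
move=> og; have [irr tr tot nb] := og.
have [cx|ncx] := pselect (closed [set y | lt y x]).
  exists (fun=> [set y | lt y x]) => [n|]; first by split=> //; exact: open_ray.
  by apply/seteqP; split=> [y []//|y yx]; exists 0.
have dense y : lt y x -> exists2 z, lt y z & lt z x.
  move=> yx; apply: contrapT => nz; apply: ncx.
  rewrite (_ : mkset _ = ~` [set z | lt y z]).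
    exact/open_closedC/(open_ray _ (order_generated_flip og)).
  apply/seteqP; split=> [z zx yz|z /= nyz]; first by apply: nz; exists z.
  by case: (tot z y) => [zy|->//|//]; exact: tr yx.
pose D := [set d | open [set d]] `&` [set y | lt y x].
have [|d [od _]|V [oV VP VU]] := @countable_clopen_sequence X X D (fun d => [set y | ~ lt d y]).
- apply: sub_countable (countable_isolated_points hX imX).
  by apply: subset_card_le => y [].
- exact: clopen_initial_segment.
exists V => //; rewrite VU; apply/seteqP; split=> [y [d [_ /= dx] ndy]|y yx].
  by case: (tot y d) => [yd|->//|//]; exact: tr dx.
have [z yz zx] := dense y yx.
have [d [od yd dx]] := isolated_point_between og yz zx.
by exists d => // /(tr _ _ _ yd)/irr.
Qed.

Lemma clopen_sequence_setC1 (lt : X -> X -> Prop) (x : X) :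
    order_generated lt ->
  exists2 V : nat -> set X, forall n, clopen (V n) & \bigcup_n V n = ~` [set x].
Proof.
move=> og; have [V oV VU] := clopen_sequence_below x og.
have [W oW WU] := clopen_sequence_below x (order_generated_flip og).
exists (fun n => V n `|` W n) => [n|]; first exact: clopenU.
rewrite bigcupU VU WU; apply/seteqP; split=> [y [yx|xy] /= e|y /= yx].
- by rewrite e in yx; exact: (og_irr og yx).
- by rewrite e in xy; exact: (og_irr og xy).
- by case: (og_total og y x) => ?; [left| |right].
Qed.

End CompactLOTS.

(** * Well-orders with clopen initial segments *)

Lemma compact_cover_compact (X : topologicalType) (K : set X) :
  compact K -> cover_compact K.
Proof.
have [->|/set0P[x0 _]] := eqVneq K set0; first by move=> _ I D f _ _; exists fset0%fset.
(* [compact_cover] is stated for pointed spaces; the point comes from the nonempty [K]. *)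
pose pX : ptopologicalType := HB.pack X (isPointed.Build X x0).
by move=> cK; have : @compact pX K := cK; rewrite compact_cover.
Qed.

Section ClopenWellOrder.
Context (X : topologicalType).

(** Reflexivity, totality and transitivity of [r] on [U] follow from the least elements of sets of
    at most three points, with antisymmetry. *)
Definition clopen_well_order (U : set X) (r : X -> X -> Prop) : Prop :=
  [/\ forall A : set X, A `<=` U -> A !=set0 -> exists2 z, A z & forall y, A y -> r z y,
      forall x y, U x -> U y -> r x y -> r y x -> x = y &
      forall a, U a -> clopen [set b | U b /\ r b a]].

Definition ordinal_like (U : set X) : Prop :=
  countable U /\ exists r, clopen_well_order U r.

Lemma ordinal_like0 : ordinal_like set0.
Proof.
split; first exact: countable0.
by exists (fun _ _ => True); split=> // A A0 [x /A0].
Qed.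

Lemma ordinal_like_clopen_subset (U V : set X) :
  ordinal_like U -> clopen V -> V `<=` U -> ordinal_like V.
Proof.
move=> [cU [r [rmin ranti rseg]]] cV VU; split.
  by apply: sub_countable cU; exact: subset_card_le.
exists r; split=> [A AV|x y Vx Vy|a Va].
- by apply: rmin; exact: subset_trans VU.
- by apply: ranti; exact: VU.
rewrite (_ : mkset _ = V `&` [set b | U b /\ r b a]); first exact/clopenI/rseg/VU.
by apply/seteqP; split=> b [Vb]; [move=> rba; do 2 split => //; exact: VU|case].
Qed.

Lemma clopen_bigcup_lt (V : nat -> set X) (N : nat) :
  (forall n, clopen (V n)) -> clopen (\bigcup_(n < N) V n).
Proof.
move=> cV; split; first by apply: bigcup_open => n _; case: (cV n).
by apply: closed_bigcup => // n _; case: (cV n).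
Qed.

(** Order points first by the least index of a [V n] containing them, then inside that set. A
    segment is then a finite union of sets [V n] and a segment of one more, hence clopen. *)
Lemma ordinal_like_bigcup (V : nat -> set X) :
    (forall n, clopen (V n)) -> (forall n, ordinal_like (V n)) ->
  ordinal_like (\bigcup_n V n).
Proof.
move=> cV oV; split; first by apply: bigcup_countable => // n _; case: (oV n).
have /choice[r rP] : forall n, exists r, clopen_well_order (V n) r.
  by move=> n; case: (oV n).
have /choice[idx idxP] : forall x, exists n, (\bigcup_n V n) x ->
    V n x /\ forall m, V m x -> n <= m.
  move=> x; have [[n _ Vn]|nV] := pselect ((\bigcup_n V n) x); last by exists 0.
  have ex : exists n, `[< V n x >] by exists n; apply/asboolP.
  exists (ex_minn ex) => _; case: ex_minnP => m /asboolP Vm mmin.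
  by split=> // k /asboolP; exact: mmin.
exists (fun a b => idx a < idx b \/ idx a = idx b /\ r (idx a) a b); split.
- move=> A AV [x Ax].
  have ex : exists n, `[< exists2 y, A y & idx y = n >].
    by exists (idx x); apply/asboolP; exists x.
  case: (ex_minnP ex) => n /asboolP[y Ay yn] nmin.
  have [rmin _ _] := rP n.
  have [|| z [Az zn] zmin] := rmin (A `&` [set z | idx z = n]).
  - by move=> z [Az <-]; case: (idxP z (AV _ Az)).
  - by exists y.
  exists z => // w Aw; have := nmin (idx w); rewrite leq_eqVlt -{2}zn => H.
  have /orP[/eqP nw|nw] := H (asboolT (ex_intro2 _ _ w Aw erefl)); last by left.
  by right; rewrite zn; split=> //; apply: zmin.
- move=> x y Ux Uy [xy|[xy rxy]] [yx|[yx ryx]].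
  + by have := ltn_trans xy yx; rewrite ltnn.
  + by rewrite yx ltnn in xy.
  + by rewrite xy ltnn in yx.
  have [_ ranti _] := rP (idx x); have [Vx _] := idxP x Ux; have [Vy _] := idxP y Uy.
  by apply: ranti => //; rewrite ?xy.
- move=> a Ua; have [Va amin] := idxP a Ua; have [_ _ rseg] := rP (idx a).
  rewrite (_ : mkset _ = \bigcup_(n < idx a) V n `|` [set b | V (idx a) b /\ r (idx a) b a]).
    by apply: clopenU; [exact: clopen_bigcup_lt|exact: rseg].
  apply/seteqP; split=> [b [Ub]|b].
    have [Vb bmin] := idxP b Ub => -[ba|[ba rba]]; first by left; exists (idx b).
    by right; rewrite -ba.
  case=> [[n /= na Vnb]|[Vb rba]].
    have Ub : (\bigcup_n V n) b by exists n.
    have [_ bmin] := idxP b Ub.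
    by split=> //; left; apply: leq_ltn_trans na; exact: bmin.
  have Ub : (\bigcup_n V n) b by exists (idx a).
  have [_ bmin] := idxP b Ub; split=> //.
  have := bmin _ Vb; rewrite leq_eqVlt => /orP[/eqP e|]; last by left.
  by right; rewrite e.
Qed.

(** The segment ending at [x] is all of [W] with [x], clopen by hypothesis; the other segments are
    those of [W]. *)
Lemma ordinal_like_add_top (W : set X) (x : X) :
    ordinal_like W -> ~ W x -> clopen (W `|` [set x]) ->
  ordinal_like (W `|` [set x]).
Proof.
move=> [cW [r [rmin ranti rseg]]] nWx cWx; split.
  rewrite -bigcup2E; apply: bigcup_countable => // -[|[|n]] _ /=.
  - exact: cW.
  - exact: countable1.
  - exact: countable0.
have neq y : W y -> y <> x by move=> Wy yx; apply: nWx; rewrite -yx.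
exists (fun a b => b = x \/ [/\ a <> x, b <> x & r a b]); split.
- move=> A AW [a Aa].
  have [[b [Ab Wb]]|nW] := pselect (exists b, A b /\ W b).
    have [||z [Az Wz] zmin] := rmin (A `&` W); first by move=> y [].
      by exists b.
    exists z => // y Ay; have [Wy|->] := AW _ Ay; last by left.
    by right; split; [exact: neq|exact: neq|exact: zmin].
  exists a => // y Ay; left; have [Wy|//] := AW _ Ay.
  by case: nW; exists y.
- move=> y z [Wy|->] [Wz|->] //.
  + move=> [/(neq _ Wz)//|[_ _ yz]] [/(neq _ Wy)//|[_ _ zy]].
    exact: ranti.
  + by move=> _ [/(neq _ Wy)//|[]].
  + by move=> [/(neq _ Wz)//|[]].
- move=> a [Wa|->]; last first.
    rewrite (_ : mkset _ = W `|` [set x]) //.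
    by apply/seteqP; split=> b; [case|move=> ?; split=> //; left].
  rewrite (_ : mkset _ = [set b | W b /\ r b a]); first exact: rseg.
  apply/seteqP; split=> b.
    move=> [Wb [/(neq _ Wa)//|[bx _ ba]]].
    by split=> //; case: Wb.
  move=> [Wb ba]; split; first by left.
  by right; split=> //; exact: neq.
Qed.

Hypothesis compactX : compact [set: X].

(** By compactness finitely many ordinal-like clopen sets cover [K]; their union is ordinal-like,
    and [K] is a clopen subset of it. *)
Lemma ordinal_like_of_local (K : set X) : clopen K ->
    (forall x, K x -> exists U, [/\ clopen U, U x & ordinal_like U]) ->
  ordinal_like K.
Proof.
move=> cK loc.
have /choice[U UP] : forall x, exists U, clopen U /\ ordinal_like U /\ (K x -> U x).
  move=> x; have [/loc[U [? ? ?]]|nKx] := pselect (K x); first by exists U.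
  by exists set0; split; [exact: clopen0|split=> //; exact: ordinal_like0].
have : compact K by apply: subclosed_compact compactX _ => //; case: cK.
move=> /compact_cover_compact/(_ X K U)[x _|x Kx|D DK KD].
- by case: (UP x) => -[].
- by exists x => //; have [_ [_]] := UP x; exact.
have [||V [cV VP VU]] := @countable_clopen_sequence X X [set` D] U.
- exact: countable_fset.
- by move=> d _; case: (UP d).
apply: (@ordinal_like_clopen_subset (\bigcup_n V n)) => //; last by rewrite VU.
apply: ordinal_like_bigcup => // n.
by case: (VP n) => [->|[d _ ->]]; [exact: ordinal_like0|case: (UP d) => _ []].
Qed.

(* A point without an ordinal-like clopen neighbourhood cannot be isolated in the
   set of all such points: peeling off the shells [V n] around it would place it on
   top of an ordinal-like sum. *)
Lemma ordinal_like_setT :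
    (forall P : set X, P !=set0 ->
      exists2 x, P x & exists2 U, nbhs x U & P `&` U `<=` [set x]) ->
    (forall x : X, exists2 V : nat -> set X,
      forall n, clopen (V n) & \bigcup_n V n = ~` [set x]) ->
  ordinal_like [set: X].
Proof.
move=> scattered shells; apply: ordinal_like_of_local; first exact: clopenT.
pose P : set X := [set x | ~ exists U, [/\ clopen U, U x & ordinal_like U]].
suff P0 : ~ (P !=set0) by move=> x _; apply: contrapT => Px; apply: P0; exists x.
move=> /scattered[x Px [O nO PO]]; apply: Px.
have [V cV VU] := shells x.
have : compact (~` O°).
  by apply: subclosed_compact compactX _ => //; exact/open_closedC/open_interior.
move=> /compact_cover_compact/(_ nat setT V)[n _|y nOy|D _ OD].
- by case: (cV n).
- by rewrite /cover VU => yx; apply: nOy; rewrite yx.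
(* The first [N] shells cover the complement of the interior of [O], so what they leave is a clopen
   neighbourhood of [x] inside [O]. *)
pose N := (\max_(n <- D) n).+1.
pose U := ~` \bigcup_(n < N) V n.
have cU : clopen U.
  have [oN cN] := clopen_bigcup_lt N cV.
  by split; [exact: closed_openC|exact: open_closedC].
have UO : U `<=` O.
  move=> y Uy; apply: interior_subset; apply: contrapT => /OD[n /= nD Vn].
  by apply: Uy; exists n => //=; rewrite ltnS; apply: (@leq_bigmax_seq _ _ xpredT id).
have Vx n : ~ V n x.
  by move=> Vn; have : (\bigcup_n V n) x by [exists n]; rewrite VU; apply.
have Ux : U x by move=> [n _ /Vx].
exists U; split=> //.
have UE : U = \bigcup_n (U `&` V n) `|` [set x].
  rewrite -setI_bigcupr VU; apply/seteqP; split=> [y Uy|y [[]//|->//]].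
  by have [->|/eqP yx] := eqVneq y x; [right|left].
rewrite UE; apply: ordinal_like_add_top; last by rewrite -UE.
- have cUV n : clopen (U `&` V n) by exact: clopenI.
  (* Inside [O] the only point of [P] is [x], which no shell contains, so every point of [U] in a
     shell has an ordinal-like clopen neighbourhood. *)
  apply: ordinal_like_bigcup => // n; apply: ordinal_like_of_local => // y [Uy Vy].
  apply: contrapT => Py; apply: (Vx n).
  by rewrite -(PO y) //; split=> //; exact: UO.
- by move=> [n _ [_ /Vx]].
Qed.

End ClopenWellOrder.

(** * From a clopen well-order on a compact space to a successor ordinal *)

Section FromClopenWellOrder.
Context (X : topologicalType) (r : X -> X -> Prop).
Hypothesis compactX : compact [set: X].
Hypothesis countableX : countable [set: X].
Hypothesis rP : clopen_well_order [set: X] r.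

Let rmin (A : set X) : A !=set0 -> exists2 z, A z & forall y, A y -> r z y.
Proof. by case: rP => + _ _; apply. Qed.

Let ranti x y : r x y -> r y x -> x = y.
Proof. by case: rP => _ + _; apply. Qed.

Let rseg a : clopen [set b | r b a].
Proof.
case: rP => _ _ /(_ a I); congr clopen.
by apply/seteqP; split=> b; [case|split].
Qed.

Let rtotal x y : r x y \/ r y x.
Proof.
have [|z [->|->] zmin] := rmin (A := [set x; y]); first by exists x; left.
- by left; apply: zmin; right.
- by right; apply: zmin; left.
Qed.

Let rrefl x : r x x. Proof. by case: (rtotal x x). Qed.

Let rtrans y x z : r x y -> r y z -> r x z.
Proof.
move=> xy yz; have [|w wA wmin] := rmin (A := [set x] `|` [set y; z]).
  by exists x; left.
case: wA => [wx|[wy|wz]].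
- by rewrite -wx; apply: wmin; right; right.
- have yx : r y x by rewrite -wy; apply: wmin; left.
  by rewrite (ranti xy yx).
- have zy : r z y by rewrite -wz; apply: wmin; right; left.
  by rewrite -(ranti yz zy).
Qed.

(** Without a greatest element, the open segments would cover [X] with no finite subcover. *)
Let rmax : [set: X] !=set0 -> exists m, forall x, r x m.
Proof.
move=> [x0 _]; apply: contrapT => nomax.
have unb a : exists b, ~ r b a.
  apply: contrapT => na; apply: nomax; exists a => x.
  by apply: contrapT => nxa; apply: na; exists x.
have [a _|x _|D _ cover_D] :=
    compact_cover_compact compactX (D := setT) (f := fun a => [set b | r b a]).
- by case: (rseg a).
- by exists x => //=; exact: rrefl.
have [c cD] : exists c, forall d, d \in (D : seq X) -> r d c.
  elim: (D : seq X) => [|d s [c cs]]; first by exists x0.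
  have [cd|dc] := rtotal c d; last first.
    by exists c => e; rewrite inE => /orP[/eqP->//|/cs].
  exists d => e; rewrite inE => /orP[/eqP->//|/cs ec].
  exact: rtrans cd.
have [b nbc] := unb c; have [d /= dD bd] := cover_D b I.
by apply: nbc; apply: rtrans bd _; exact: cD.
Qed.

Lemma clopen_well_order_successor :
  [set: X] !=set0 -> homeomorphic_to_countable_successor_ordinal X.
Proof.
(* The greatest element [m] becomes the [None] of [osucc]; the remaining points carry the
   ordinal. *)
move=> /rmax[m mP]; pose A := {x : X | x != m}.
pose le (x y : A) := `[< r (val x) (val y) >].
have lerefl : reflexive le by move=> x; apply/asboolP.
have leanti : antisymmetric le.
  by move=> x y /andP[/asboolP xy /asboolP yx]; exact/val_inj/ranti.
have letrans : transitive le.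
  by move=> y x z /asboolP xy /asboolP yz; apply/asboolP; exact: rtrans yz.
have letotal : total le.
  by move=> x y; apply/orP; case: (rtotal (val x) (val y)) => ?; [left|right]; apply/asboolP.
pose PA : porderType (Order.Disp tt tt) := HB.pack A
  (Order.Le_isPOrder.Build (Order.Disp tt tt) A lerefl leanti letrans).
pose OA : orderType (Order.Disp tt tt) := HB.pack A PA
  (Order.POrder_isTotal.Build (Order.Disp tt tt) PA letotal).
exists (Order.Disp tt tt), OA; split.
- move=> S [x Sx]; have [|z [z' Sz' zz'] zmin] :=
      rmin (A := [set y | exists2 y' : A, y' \in S & val y' = y]).
    by exists (val x), x.
  exists z'; split.
    by split=> // y Sy; apply/asboolP; rewrite zz'; apply: zmin; exists y.
  move=> w [Sw wmin]; apply: (leanti); apply/andP; split; last exact: wmin.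
  by apply/asboolP; rewrite zz'; apply: zmin; exists w.
- have /countable_injP[f finj] := countableX.
  apply/countable_injP; exists (f \o val) => x y _ _ fxy.
  by apply: val_inj; apply: finj; rewrite ?inE.
pose Y := order_topology (osucc OA).
pose f (x : X) : Y := insub x.
pose g (y : Y) : X := if y is Some a then val (a : A) else m.
have fK : cancel f g.
  by move=> x; rewrite /f; case: insubP => [u _ <-//|]; rewrite negbK => /eqP ->.
have gK : cancel g f.
  move=> [a|]; first by rewrite /f /= valK.
  by rewrite /f /g insubF// eqxx.
have ltE x y : (f x < f y)%O <-> ~ r y x.
  have leE u v : (f u <= f v)%O <-> r u v.
    rewrite -{2}[u]fK -{2}[v]fK; case: (f u) => [a|]; case: (f v) => [b|] //=.
    - by split=> /asboolP.
    - split=> // mb; have /eqP := valP b; case.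
      by apply: ranti => //; exact: mP.
  by rewrite Order.TotalTheory.ltNge; split=> [/negP nle /leE//|nr]; apply/negP => /leE.
have cf : continuous f.
  have above a : open [set y | ~ r y a] by case: (rseg a) => _ /closed_openC.
  (* A strict lower ray contains, with each [y], the open segment ending at [y]. *)
  have below b : open [set y | ~ r b y].
    rewrite openE => y /= nby; have [oy _] := rseg y.
    have : nbhs y [set z | r z y] by apply: open_nbhs_nbhs; split; [|exact: rrefl].
    by apply: filterS => z zy bz; apply: nby; exact: rtrans zy.
  move=> x U /(og_nbhs (order_topology_generated (osucc OA)))[a [b boxU]].
  rewrite -[a]gK -[b]gK in boxU.
  pose box := order_box (fun u v : Y => (u < v)%O) (f x) (f (g a)) (f (g b)).
  apply: filterS (_ : nbhs x (f @^-1` box)).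
    by move=> y /boxU.
  apply: filterI.
    have [/ltE xa|nxa] := pselect (f (g a) < f x)%O; last exact: nearW.
    have : nbhs x [set y | ~ r y (g a)] by apply: open_nbhs_nbhs; split; [exact: above|].
    by apply: filterS => y ya _; apply/ltE.
  have [/ltE xb|nxb] := pselect (f x < f (g b))%O; last exact: nearW.
  have : nbhs x [set y | ~ r (g b) y] by apply: open_nbhs_nbhs; split; [exact: below|].
  by apply: filterS => y yb _; apply/ltE.
exists f, g; split=> //; apply/continuous_closedP => C cC.
(* A continuous bijection from a compact space to a Hausdorff space is closed. *)
have -> : g @^-1` C = f @` C.
  apply/seteqP; split=> [y Cy|_ [x Cx <-]]; first by exists (g y); rewrite ?gK.
  by rewrite /= fK.
apply: compact_closed; first exact: order_hausdorff.
apply: continuous_compact; first exact: continuous_subspaceT.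
exact: subclosed_compact compactX _.
Qed.

End FromClopenWellOrder.

Theorem corollary1p4 (X : topologicalType)
    (X_nonempty : [set: X] !=set0)
    (X_hausdorff : hausdorff_space X)
    (images_LOTS : forall Y : topologicalType, continuous_image X Y -> LOTS Y) :
  homeomorphic_to_countable_successor_ordinal X.
Proof.
have imX : image_LOTS X := images_LOTS.
have [lt og] : exists lt, @order_generated X lt.
  apply/LOTS_order/images_LOTS; split=> //.
  by exists id; [move=> x; exact: cvg_id|rewrite image_id].
have cX := image_LOTS_compact X_hausdorff imX og.
have [cntX [r rP]] : ordinal_like [set: X].
  apply: ordinal_like_setT => // [P P0|x].
    exact: exists_isolated_point og imX P0.
  exact (clopen_sequence_setC1 X_hausdorff imX x og).
exact: clopen_well_order_successor rP X_nonempty.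
Qed.
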